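(* Let $A$ and $B$ be independent nonnegative real random variables, let $X=B-A$ have distribution function $F_X(x)=\mathbb{P}[X\leqslant x]$, and assume $\mathbb{P}[X<0]>0$. Then there is a unique measurable bounded function $F:[0,\infty)\to\mathbb{R}$ such that $$F(x)=1-\int_x^\infty F(y-x)\,dF_X(y)\qquad\text{for all } x\geqslant 0.$$
   Context: The integral $\int_x^\infty F(y-x)\,dF_X(y)$ is the Lebesgue–Stieltjes integral over $(x,\infty)$ with respect to the law of $X$ (so that $\int_x^\infty dF_X(y)=1-F_X(x)$). ''Measurable'' means Borel measurable and ''bounded'' means $\sup_{t\geqslant 0}|F(t)|<\infty$; functions are identified only if they agree at every point. *)

(* Defs.v *)
From mathcomp Require Import all_boot all_order all_algebra.
From mathcomp Require Import all_classical all_reals all_analysis.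

Set Implicit Arguments.
Unset Strict Implicit.
Unset Printing Implicit Defensive.

Import Order.TTheory GRing.Theory Num.Theory.
Import numFieldNormedType.Exports.

Local Open Scope classical_set_scope.
Local Open Scope ring_scope.

Definition independent_RV2 (d d1 d2 : measure_display) (T : measurableType d)
    (T1 : measurableType d1) (T2 : measurableType d2) (R : realType)
    (P : probability T R) (X : {RV P >-> T1}) (Y : {RV P >-> T2}) : Prop :=
  forall (U : set T1) (V : set T2), measurable U -> measurable V ->
    P (X @^-1` U `&` Y @^-1` V) = (P (X @^-1` U) * P (Y @^-1` V))%E.

(* A function [0, +oo[ -> R is represented by a total function R -> R of which
   only the values on [0, +oo[ are constrained: for x >= 0 the integral only
   evaluates F at points y - x > 0. The measure dF_X is the law of X; under
   boundedness and measurability the integrand is integrable, so the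
   real-valued Rintegral is not a junk value. *)
Definition bounded_measurable_solution (d : measure_display)
    (T : measurableType d) (R : realType) (P : probability T R)
    (X : {RV P >-> R}) (F : R -> R) : Prop :=
  [/\ measurable_fun (`[0, +oo[ : set R) F,
      [bounded F t | t in `[0, +oo[] &
      forall x : R, 0 <= x ->
        F x = 1 - \int[distribution P X]_(y in `]x, +oo[) F (y - x)].

(* Main.v *)
Require Import Defs.
From mathcomp Require Import all_boot all_order all_algebra.
From mathcomp Require Import all_classical all_reals all_analysis.
From mathcomp Require Import measurable_realfun.

Import Order.TTheory GRing.Theory Num.Theory.
Import numFieldNormedType.Exports.

(** Let mu be the law of X, and let K be the operator
      (K f)(x) = \int_(x, +oo) f(y - x) dmu(y),
    so that the equation to solve reads F = 1 - K F. For x >= 0 the domain of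
    integration has mass mu(x, +oo) <= q := P(X > 0), and only values of f on
    [0, +oo) are sampled, so that K multiplies sup norms over [0, +oo) by at
    most q (norm_overshoot_le). Because P(X < 0) > 0, q is smaller than 1
    (pos_mass_lt1) and F |-> 1 - K F is a contraction.

    Uniqueness: the difference D of two solutions satisfies D = - K D, hence
    |D| <= q ^ n * C for all n.

    Existence: the iterates of F |-> 1 - K F from 0 stay measurable, because
    K preserves measurability by Tonelli's theorem (measurable_overshoot), and
    stay bounded by 1 / (1 - q). Consecutive iterates differ by at most q ^ n,
    so that they converge pointwise on [0, +oo). The limit is measurable, obeys
    the same bound, and dominated convergence (overshoot_cvg) carries the
    recurrence over to it. *)

Local Open Scope classical_set_scope.
Local Open Scope ring_scope.

Set Implicit Arguments.
Unset Strict Implicit.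
Unset Printing Implicit Defensive.

Section OvershootOperator.
Context {R : realType} (mu : probability R R).
Implicit Types (f g : R -> R) (x M : R).

(** For a random variable Y of law mu this is the expectation of f(Y - x), the
    function of the overshoot of Y above the level x, on the event Y > x. *)
Definition overshoot f x : R := \int[mu]_(y in `]x, +oo[) f (y - x).

Definition pos_mass : R := fine (mu `]0, +oo[%classic).

Lemma pos_mass_ge0 : 0 <= pos_mass.
Proof. exact: fine_ge0. Qed.

Lemma pos_mass_lt1 : (0 < mu `]-oo, 0%R[%classic)%E -> pos_mass < 1.
Proof.
move=> neg_gt0.
have disj : `]-oo, 0[ `&` `]0, +oo[ = set0 :> set R.
  apply/seteqP; split => // y [] /=; rewrite !in_itv/= andbT => y_lt0.
  by rewrite ltNge ltW.
have sum_le1 : fine (mu `]-oo, 0%R[%classic) + pos_mass <= 1.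
  rewrite -lee_fin EFinD !fineK ?fin_num_measure//.
  by rewrite -measureU//; apply: probability_le1; exact: measurableU.
apply: lt_le_trans sum_le1; rewrite ltrDr fine_gt0// neg_gt0 /=.
by rewrite ltey_eq fin_num_measure.
Qed.

Lemma measurable_shift f x : measurable_fun (`[0, +oo[ : set R) f ->
  measurable_fun (`]x, +oo[ : set R) (fun y => f (y - x)).
Proof.
move=> mf; apply: (measurable_comp _ _ mf) => //.
- move=> _ [y /= + <-]; rewrite !in_itv/= !andbT => xy.
  by rewrite subr_ge0 ltW.
- exact: measurable_funB.
Qed.

(** The law is finite and the integrand is bounded; this holds for every real
    level, as y - x is positive on the domain whatever the sign of x. *)
Lemma overshoot_integrable f M x : measurable_fun (`[0, +oo[ : set R) f ->
    (forall t, 0 <= t -> `|f t| <= M) ->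
  mu.-integrable `]x, +oo[ (EFin \o (fun y => f (y - x))).
Proof.
move=> mf fM; apply: measurable_bounded_integrable => //.
- by rewrite ltey_eq fin_num_measure.
- exact: measurable_shift.
- exists M; split; rewrite ?num_real// => N MN y /=; rewrite in_itv/= andbT => xy.
  by rewrite (le_trans (fM _ _) (ltW MN))// subr_ge0 ltW.
Qed.

(** The contraction estimate: it is here that x >= 0 matters, since it puts
    the domain of integration inside ]0, +oo[. *)
Lemma norm_overshoot_le f M x : measurable_fun (`[0, +oo[ : set R) f ->
    (forall t, 0 <= t -> `|f t| <= M) -> 0 <= x ->
  `|overshoot f x| <= pos_mass * M.
Proof.
move=> mf fM x0.
have M0 : 0 <= M by exact: le_trans (fM 0 _).
have intf := overshoot_integrable x mf fM.
apply: le_trans (le_normr_Rintegral _ intf) _ => //.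
apply: (@le_trans _ _ (\int[mu]_(y in `]x, +oo[) M)).
  apply: le_Rintegral => //.
  - exact: integrable_norm.
  - exact: finite_measure_integrable_cst.
  - move=> y /=; rewrite in_itv/= andbT => xy.
    by apply: fM; rewrite subr_ge0 ltW.
rewrite Rintegral_cst// mulrC ler_wpM2r// fine_le ?fin_num_measure//.
apply: le_measure; rewrite ?inE// => y /=; rewrite !in_itv/= !andbT.
exact: le_lt_trans.
Qed.

Lemma overshootB f g M N x :
    measurable_fun (`[0, +oo[ : set R) f ->
    measurable_fun (`[0, +oo[ : set R) g ->
    (forall t, 0 <= t -> `|f t| <= M) -> (forall t, 0 <= t -> `|g t| <= N) ->
  overshoot (fun t => f t - g t) x = overshoot f x - overshoot g x.
Proof.
move=> mf mg fM gN; rewrite /overshoot RintegralB//.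
- exact: overshoot_integrable fM.
- exact: overshoot_integrable gN.
Qed.

(** The cut-off integrand h(x, y) is jointly measurable. Tonelli's theorem
    applies to its positive and negative parts, and the integral in y is, by
    definition, the difference of their integrals. *)
Lemma measurable_overshoot f : measurable_fun setT f ->
  measurable_fun setT (overshoot f).
Proof.
move=> mf.
pose h (p : R * R) := ((if p.1 < p.2 then f (p.2 - p.1) else 0)%:E)%E.
have mh : measurable_fun setT h.
  apply/measurable_EFinP; apply: measurable_fun_ifT => //.
  - exact: measurable_fun_ltr.
  - by apply: measurableT_comp => //; exact: measurable_funB.
have overshootE x :
    overshoot f x = fine (fubini_F mu h^\+ x - fubini_F mu h^\- x)%E.
  rewrite /overshoot /Rintegral integral_mkcond; congr fine.
  transitivity (\int[mu]_y h (x, y))%E; last first.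
    by rewrite integralE (funepos_comp h) (funeneg_comp h).
  apply: eq_integral => y _; rewrite patchE /h/= mem_setE in_itv/= andbT.
  by case: ifP.
rewrite (_ : overshoot f = fine \o
    (fun x => fubini_F mu h^\+ x - fubini_F mu h^\- x)%E); last exact/funext.
apply: measurableT_comp => //; apply: emeasurable_funB.
- by apply: measurable_fun_fubini_tonelli_F => //; exact: measurable_funepos.
- by apply: measurable_fun_fubini_tonelli_F => //; exact: measurable_funeneg.
Qed.

(** As mu is finite, the common bound is itself an integrable dominating
    function; the limit inherits measurability and the bound. *)
Lemma overshoot_cvg (f_ : (R -> R)^nat) f M x :
    (forall n, measurable_fun (`[0, +oo[ : set R) (f_ n)) ->
    (forall t, 0 <= t -> f_ ^~ t @ \oo --> f t) ->
    (forall n t, 0 <= t -> `|f_ n t| <= M) ->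
  overshoot (f_ n) x @[n --> \oo] --> overshoot f x.
Proof.
move=> mf_ f_f f_M.
have mf : measurable_fun (`[0, +oo[ : set R) f.
  apply: (measurable_fun_cvg mf_) => t /=; rewrite in_itv/= andbT.
  exact: f_f.
have fM t : 0 <= t -> `|f t| <= M.
  move=> t0; have f_t : `|f_ n t| @[n --> \oo] --> `|f t|.
    by apply: cvg_norm; exact: f_f.
  rewrite -(cvg_lim _ f_t)//; apply: limr_le; first exact: cvgP f_t.
  by apply: nearW => n; exact: f_M.
apply: fine_cvg.
rewrite fineK; last exact: integrable_fin_num (overshoot_integrable x mf fM).
apply: (@dominated_cvg _ _ _ mu _ _ _ _ (cst M%:E)) => //.
- by move=> n; apply/measurable_EFinP; exact: measurable_shift.
- move=> y /=; rewrite in_itv/= andbT => xy.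
  by apply: cvg_EFin; [exact: nearW | apply: f_f; rewrite subr_ge0 ltW].
- exact: finite_measure_integrable_cst.
- move=> n y /=; rewrite in_itv/= andbT => xy.
  by rewrite lee_fin f_M// subr_ge0 ltW.
Qed.

Hypothesis mass_lt1 : pos_mass < 1.

(** The difference of two solutions solves the homogeneous equation
    D = - K D, which the contraction estimate can be applied to n times. *)
Lemma overshoot_eq_unique f g M N :
    measurable_fun (`[0, +oo[ : set R) f ->
    measurable_fun (`[0, +oo[ : set R) g ->
    (forall t, 0 <= t -> `|f t| <= M) -> (forall t, 0 <= t -> `|g t| <= N) ->
    (forall x, 0 <= x -> f x = 1 - overshoot f x) ->
    (forall x, 0 <= x -> g x = 1 - overshoot g x) ->
  forall x, 0 <= x -> f x = g x.
Proof.
move=> mf mg fM gN fE gE.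
have bound n x : 0 <= x -> `|f x - g x| <= pos_mass ^+ n * (M + N).
  elim: n x => [|n IHn] x x0.
    rewrite expr0 mul1r (le_trans (ler_normB _ _))//.
    by rewrite lerD ?fM ?gN.
  have -> : f x - g x = - overshoot (fun t => f t - g t) x.
    by rewrite (overshootB _ mf mg fM gN) fE// gE//
       opprB addrC addrA subrK opprB addrC.
  rewrite normrN exprS -mulrA; apply: norm_overshoot_le => //.
  exact: measurable_funB.
move=> x x0; apply/eqP; rewrite -subr_eq0 -normr_le0.
have : pos_mass ^+ n * (M + N) @[n --> \oo] --> 0 * (M + N).
  by apply: cvgMr_tmp; apply: cvg_expr; rewrite ger0_norm ?pos_mass_ge0.
rewrite mul0r => /cvg_lim <- //; apply: limr_ge.
  by apply: is_cvgMr_tmp; apply: cvgP; apply: cvg_expr; rewrite ger0_norm ?pos_mass_ge0.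
by apply: nearW => n; exact: bound.
Qed.

(** The iterates are formed on the whole real line, where the defining formula
    makes sense too, so that measurability can be proved on the full space; the
    estimates concern nonnegative arguments only. *)
Definition picard n : R -> R := iter n (fun f x => 1 - overshoot f x) (cst 0).

Lemma measurable_picard n : measurable_fun setT (picard n).
Proof.
elim: n => [|n IHn]; first exact: measurable_cst.
by apply: measurable_funB => //; exact: measurable_overshoot.
Qed.

(** The constant is the fixed point of c |-> 1 + q * c, the recurrence that
    the contraction estimate gives for the sup norms. *)
Lemma norm_picard_le n x : 0 <= x -> `|picard n x| <= (1 - pos_mass)^-1.
Proof.
have ge0 : 0 <= (1 - pos_mass)^-1 by rewrite invr_ge0 subr_ge0 ltW.
elim: n x => [|n IHn] x x0; first by rewrite normr0.
have -> : (1 - pos_mass)^-1 = 1 + pos_mass * (1 - pos_mass)^-1.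
  have ne0 : 1 - pos_mass != 0 by rewrite gt_eqF// subr_gt0.
  by rewrite -{2}(mulfV ne0) -mulrDl subrK mul1r.
rewrite (le_trans (ler_normB _ _))// normr1 lerD2l.
apply: norm_overshoot_le => //.
by apply: measurable_funTS; exact: measurable_picard.
Qed.

Lemma norm_picard_diff_le n x : 0 <= x ->
  `|picard n.+1 x - picard n x| <= pos_mass ^+ n.
Proof.
have mp m : measurable_fun (`[0, +oo[ : set R) (picard m).
  by apply: measurable_funTS; exact: measurable_picard.
elim: n x => [|n IHn] x x0.
  by rewrite /= /overshoot Rintegral_cst// mul0r !subr0 normr1 expr0.
have -> : picard n.+2 x - picard n.+1 x =
    - overshoot (fun t => picard n.+1 t - picard n t) x.
  rewrite (overshootB _ (mp _) (mp _) (norm_picard_le _) (norm_picard_le _)).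
  by rewrite {1 2}/picard !iterS -/(picard _) opprB addrC addrA subrK opprB addrC.
rewrite normrN exprS; apply: norm_overshoot_le => //.
exact: measurable_funB.
Qed.

(** The increments are dominated by a geometric series. *)
Lemma is_cvg_picard x : 0 <= x -> cvgn (picard ^~ x).
Proof.
move=> x0.
rewrite (_ : picard ^~ x = series (telescope (picard ^~ x))); last first.
  by rewrite telescopeK; apply/funext => n /=; rewrite subr0.
apply: normed_cvg; apply: (series_le_cvg (v_ := geometric 1 pos_mass)).
- by move=> n; exact: normr_ge0.
- by move=> n; rewrite /= mul1r exprn_ge0 ?pos_mass_ge0.
- by move=> n; rewrite /= mul1r norm_picard_diff_le.
- by apply: is_cvg_geometric_series; rewrite ger0_norm ?pos_mass_ge0.
Qed.

Lemma overshoot_eq_exists : exists f,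
  [/\ measurable_fun (`[0, +oo[ : set R) f,
      forall t, 0 <= t -> `|f t| <= (1 - pos_mass)^-1 &
      forall x, 0 <= x -> f x = 1 - overshoot f x].
Proof.
have mp n : measurable_fun (`[0, +oo[ : set R) (picard n).
  by apply: measurable_funTS; exact: measurable_picard.
exists (fun x => limn (picard ^~ x)); split.
- by apply: (measurable_fun_cvg mp) => t /=; rewrite in_itv/= andbT => /is_cvg_picard.
- move=> t t0; rewrite -lim_norm; last exact: is_cvg_picard.
  apply: limr_le; first by apply: is_cvg_norm; exact: is_cvg_picard.
  by apply: nearW => n; exact: norm_picard_le.
- move=> x x0; apply/cvg_lim => //.
  rewrite -(@cvg_shiftn 1).
  rewrite (_ : (fun n => picard (n + 1) x) =
    (fun n => 1 - overshoot (picard n) x)); last first.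
    by apply/funext => n; rewrite addn1.
  apply: cvgB; first exact: cvg_cst.
  by apply: overshoot_cvg => // [t /is_cvg_picard//|]; exact: norm_picard_le.
Qed.

End OvershootOperator.

Theorem theorem1 (d : measure_display) (T : measurableType d) (R : realType)
    (P : probability T R) (A B X : {RV P >-> R})
    (indepAB : independent_RV2 A B)
    (A_ge0 : forall w : T, 0 <= A w)
    (B_ge0 : forall w : T, 0 <= B w)
    (XE : forall w : T, X w = B w - A w)
    (X_neg : (0 < P [set w : T | (X w < 0)%R])%E) :
  exists F : R -> R,
    bounded_measurable_solution X F /\
    forall G : R -> R, bounded_measurable_solution X G ->
      forall x : R, 0 <= x -> G x = F x.
Proof.
have boundP (f : R -> R) : [bounded f t | t in `[0, +oo[%classic] <->
    exists M, forall t, 0 <= t -> `|f t| <= M.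
  split=> [[M [_ fM]]|[M fM]].
    exists (M + 1) => t t0; apply: (fM (M + 1)); first by rewrite ltrDl.
    by rewrite /= in_itv/= andbT.
  exists M; split; rewrite ?num_real// => N MN t /=; rewrite in_itv/= andbT => t0.
  exact: le_trans (fM t t0) (ltW MN).
have tail_lt1 : pos_mass (distribution P X) < 1.
  have preimX : [set w | X w < 0] = X @^-1` `]-oo, 0[.
    by apply/seteqP; split => w /=; rewrite in_itv.
  by apply: pos_mass_lt1; move: X_neg; rewrite preimX.
have [F [mF FM FE]] := overshoot_eq_exists tail_lt1.
exists F; split; first by split => //; apply/boundP; eexists; exact: FM.
move=> G [mG /boundP[M GM] GE].
exact: (overshoot_eq_unique tail_lt1 mG mF GM FM GE FE).
Qed.
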